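(* Let $P$ be a dcpo for which $\Sigma P$ is well-filtered and coherent. Then $P$ has property R.
   Context: A dcpo is a poset in which every directed subset has a supremum (directed: nonempty, any two elements have an upper bound in the subset). For $A\subseteq P$, $\mathord{\uparrow}A=\{x\in P: x\ge a\text{ for some }a\in A\}$. $U\subseteq P$ is Scott open if $U=\mathord{\uparrow}U$ and, for every directed $D\subseteq P$, $\bigvee D\in U$ implies $D\cap U\neq\emptyset$; these sets form the Scott topology $\sigma(P)$, and $\Sigma P=(P,\sigma(P))$. A subset of a space is saturated if it is an intersection of open sets. A $T_0$ space is well-filtered if for any open $U$ and any filtered (nonempty and downward directed under $\subseteq$) family $\mathcal{K}$ of nonempty compact saturated sets, $\bigcap\mathcal{K}\subseteq U$ implies $K\subseteq U$ for some $K\in\mathcal{K}$. It is coherent if the intersection of any two compact saturated sets is compact. (Compactness does not include Hausdorffness.) $P$ has property R if for any family $\{\mathord{\uparrow}F_i : i\in I\}$ with $I\neq\emptyset$ and each $F_i\subseteq P$ nonempty finite, and any $U\in\sigma(P)$, $\bigcap_{i\in I}\mathord{\uparrow}F_i\subseteq U$ implies $\bigcap_{i\in I_0}\mathord{\uparrow}F_i\subseteq U$ for some nonempty finite $I_0\subseteq I$. *)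

(* Defs.v *)
From HB Require Import structures.
From mathcomp Require Import all_boot all_order.
From mathcomp Require Import all_classical topology.

Set Implicit Arguments.
Unset Strict Implicit.
Unset Printing Implicit Defensive.

Import Order.TTheory.

Local Open Scope classical_set_scope.
Local Open Scope order_scope.

Section Poset.
Context {d : Order.disp_t} {P : porderType d}.
Implicit Types A D U : set P.

Definition directed D :=
  D !=set0 /\
  forall x y, D x -> D y -> exists z, [/\ D z, x <= z & y <= z].

Definition up A : set P := [set x | exists2 a, A a & a <= x].

(* On a poset that is not a dcpo, only the directed sets that do have a
   supremum are constrained. *)
Definition scott_open U :=
  U = up U /\
  forall D x, directed D -> supremums D x -> U x -> D `&` U !=set0.

End Poset.

Definition dcpo {d : Order.disp_t} (P : porderType d) :=
  forall D : set P, directed D -> supremums D !=set0.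

Definition Sigma {d : Order.disp_t} (P : porderType d) : Type := P.

Section ScottTopology.
Context {d : Order.disp_t} (P : porderType d).

HB.instance Definition _ := Choice.on (Sigma P).

Let op : set_system (Sigma P) := @scott_open d P.

Let opT : op setT.
Proof.
split=> [|D x [[y Dy] _] _ _]; last by exists y.
by rewrite predeqE => x; split=> // _; exists x.
Qed.

Let opI : setI_closed op.
Proof.
move=> U V [Uup Uinacc] [Vup Vinacc]; split.
  rewrite predeqE => x; split=> [UVx|[y [Uy Vy] yx]]; first by exists x.
  by split; [rewrite Uup|rewrite Vup]; exists y.
move=> D x dirD supx [Ux Vx].
have [y [Dy Uy]] := Uinacc _ _ dirD supx Ux.
have [z [Dz Vz]] := Vinacc _ _ dirD supx Vx.
have [t [Dt yt zt]] := dirD.2 _ _ Dy Dz.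
by exists t; split=> //; split; [rewrite Uup; exists y|rewrite Vup; exists z].
Qed.

Let op_bigU (I : Type) (f : I -> set (Sigma P)) :
  (forall i, op (f i)) -> op (\bigcup_i f i).
Proof.
move=> opf; split.
  rewrite predeqE => x; split=> [Ux|[y [i _ fiy] yx]]; first by exists x.
  by exists i => //; rewrite (opf i).1; exists y.
move=> D x dirD supx [i _ fix_].
by have [y [Dy fiy]] := (opf i).2 _ _ dirD supx fix_; exists y; split=> //; exists i.
Qed.

HB.instance Definition _ :=
  @isOpenTopological.Build (Sigma P) op opT opI op_bigU.

Lemma Sigma_openE : @open (Sigma P) = @scott_open d P.
Proof. by []. Qed.

End ScottTopology.

Section Space.
Context {T : topologicalType}.

Definition saturated (A : set T) :=
  exists2 G : set (set T), G `<=` open & A = \bigcap_(U in G) U.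

Definition filtered (K : set (set T)) :=
  K !=set0 /\
  forall A B, K A -> K B -> exists C, [/\ K C, C `<=` A & C `<=` B].

End Space.

Definition well_filtered (T : topologicalType) :=
  kolmogorov_space T /\
  forall (U : set T) (K : set (set T)),
    open U -> filtered K ->
    (forall A, K A -> [/\ A !=set0, compact A & saturated A]) ->
    \bigcap_(A in K) A `<=` U -> exists2 A, K A & A `<=` U.

Definition coherent (T : topologicalType) :=
  forall A B : set T,
    compact A -> saturated A -> compact B -> saturated B -> compact (A `&` B).

Definition property_R {d : Order.disp_t} (P : porderType d) :=
  forall (I : Type) (F : I -> set P) (U : set P),
    [set: I] !=set0 -> (forall i, F i !=set0 /\ finite_set (F i)) ->
    scott_open U ->
    \bigcap_i up (F i) `<=` U ->
    exists I0 : set I,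
      [/\ I0 !=set0, finite_set I0 & \bigcap_(i in I0) up (F i) `<=` U].

(* Main.v *)
Require Import Defs.
From mathcomp Require Import all_boot all_order.
From mathcomp Require Import all_classical topology.

(** Call an intersection of finitely many (at least one) of the sets [up (F i)]
    a finite meet.  The finite meets form a filtered family of sets whose
    intersection is the intersection of all the [up (F i)], so
    well-filteredness yields a finite meet inside [U] as soon as the finite
    meets are nonempty, compact and saturated.
    - If some finite meet is empty, then it is already contained in [U].
    - Upper sets are saturated in [Sigma P] ([upper_saturated]), and they are
      stable under intersection.
    - Each [up (F i)] is compact since [F i] is finite ([compact_up_finite]), and
      coherence transfers compactness to finite meets. *)

Set Implicit Arguments.
Unset Strict Implicit.
Unset Printing Implicit Defensive.

Import Order.TTheory.

Local Open Scope classical_set_scope.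
Local Open Scope order_scope.

Section ScottSpace.
Context {d : Order.disp_t} {P : porderType d}.
Implicit Types (A F : set P) (x a : P).

Definition upper A := forall x y, A x -> x <= y -> A y.

Lemma upper_up A : upper (up A).
Proof. by move=> x y [a Aa ax] xy; exists a => //; exact: le_trans xy. Qed.

Lemma upper_setI A B : upper A -> upper B -> upper (A `&` B).
Proof. by move=> uA uB x y [Ax Bx] xy; split; [exact: uA xy|exact: uB xy]. Qed.

Lemma scott_open_upper U : scott_open U -> upper U.
Proof. by move=> [-> _]; exact: upper_up. Qed.

(** A directed set lying below [x] has its supremum below [x]. *)
Lemma scott_open_not_le x : scott_open [set y | ~~ (y <= x)].
Proof.
split.
  rewrite predeqE => y; split=> [nyx|[z /= nzx zy]]; first by exists y.
  by apply: contra nzx => yx; exact: le_trans yx.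
move=> D s _ [_ s_least] /= nsx; apply: contrapT => D0.
move/negP: nsx; apply; apply: s_least => y Dy.
by apply/negPn/negP => nyx; apply: D0; exists y.
Qed.

(** An upper set is cut out by the complements of the principal ideals
    generated by the points outside it. *)
Lemma upper_saturated A : upper A -> @saturated (Sigma P) A.
Proof.
move=> uA; exists [set U : set (Sigma P) | open U /\ A `<=` U].
  by move=> U [].
rewrite predeqE => x; split=> [Ax U [_]|allU]; first exact.
apply: contrapT => nAx.
suff : ~~ ((x : P) <= x) by rewrite lexx.
apply: (allU [set y : P | ~~ (y <= x)]); split.
  exact: scott_open_not_le.
by move=> y Ay /=; apply/negP => yx; apply/nAx/(uA y).
Qed.

(** Every open neighbourhood of [a] contains all of [up [set a]], so [a] is a
    cluster point of every filter on [up [set a]]. *)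
Lemma compact_up1 a : @compact (Sigma P) (up [set a]).
Proof.
move=> G GF Ga; exists a; split; first by exists a.
move=> B C GB; rewrite nbhsE => -[V [oV Va] VC].
have [y [By [_ -> ay]]] := filter_ex (filterI GB Ga).
by exists y; split=> //; apply: VC; exact: (scott_open_upper oV) Va ay.
Qed.

Lemma compact_up_finite F : finite_set F -> @compact (Sigma P) (up F).
Proof.
move=> /finite_seqP[s ->]; elim: s => [|a s IHs].
  suff -> : up [set` [::]] = set0 :> set P by exact: compact0.
  by rewrite predeqE => x; split=> // -[].
suff -> : up [set` a :: s] = up [set a] `|` up [set` s].
  exact: (compactU (@compact_up1 a) IHs).
rewrite predeqE => x; split.
  move=> [b /=]; rewrite inE => /orP[/eqP -> ax|bs bx].
    by left; exists a.
  by right; exists b.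
move=> [[_ -> ax]|[b /= bs bx]]; first by exists a => //=; rewrite inE eqxx.
by exists b => //=; rewrite inE bs orbT.
Qed.

End ScottSpace.

Theorem proposition5p10 (d : Order.disp_t) (P : porderType d) :
  dcpo P -> well_filtered (Sigma P) -> coherent (Sigma P) -> property_R P.
Proof.
move=> _ [_ wfP] cohP I F U [i0 _] finF oU capU.
(* With compactness built into the family of finite meets, coherence is applied
   only to the intersection of two members, with no induction on [J]. *)
pose K : set (set (Sigma P)) := [set A : set P |
  [/\ @compact (Sigma P) A, upper A &
    exists J : set I,
      [/\ J !=set0, finite_set J & A = \bigcap_(i in J) up (F i)]]].
have KF i : K (up (F i)).
  split; [exact: compact_up_finite (finF i).2 | exact: upper_up |].
  by exists [set i]; rewrite bigcap_set1; split=> //; exists i.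
have filtK : filtered K.
  split; first by exists (up (F i0)).
  move=> A B [cA uA [J [[j Jj] finJ eA]]] [cB uB [L [_ finL eB]]].
  exists (A `&` B); split; [|exact: subIsetl|exact: subIsetr].
  split; [|exact: upper_setI|].
    by apply: cohP => //; exact: upper_saturated.
  exists (J `|` L); rewrite finite_setU bigcap_setU eA eB.
  by split=> //; exists j; left.
suff [A [_ _ [J [J0 finJ eA]]] AU] : exists2 A, K A & A `<=` U.
  by exists J; split=> //; rewrite -eA.
have [K0|nK0] := pselect (K set0); first by exists set0.
apply: wfP => //.
- move=> A KA; split; last 2 first.
  + by case: KA.
  + by apply: upper_saturated; case: KA.
  by apply/set0P/eqP => A0; apply: nK0; rewrite -A0.
- by move=> x Kx; apply: capU => i _; exact: (Kx _ (KF i)).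
Qed.
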